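(* For every $\mathfrak u\in\langle\Gamma\rangle$, $(\mathrm{id}\otimes\Delta)\Delta(\mathfrak u)=(\Delta\otimes\mathrm{id})\Delta(\mathfrak u)$.
   Context: Let $q$ be a prime power. Let $\Gamma=\{x_{n,\varepsilon}\}_{n\in\mathbb N,\varepsilon\in\mathbb F_q^*}$ with weights $w(x_{n,\varepsilon})=n$, $\langle\Gamma\rangle$ the set of words over $\Gamma$ (empty word $1$, juxtaposition = concatenation, depth = number of letters, weight = sum of letter weights), $\mathfrak D$ the $\mathbb F_q$-vector space with basis $\langle\Gamma\rangle$; write $x_n:=x_{n,1}$. For positive integers $r,s,j$ put $\Delta^j_{r,s}=(-1)^{r-1}\binom{j-1}{r-1}+(-1)^{s-1}\binom{j-1}{s-1}$ if $(q-1)\mid j$ and $0$ otherwise. The bilinear products $\diamond,\sqcup\!\sqcup$ on $\mathfrak D$ are defined recursively by $1\diamond\mathfrak a=\mathfrak a\diamond1=\mathfrak a$, $1\sqcup\!\sqcup\mathfrak a=\mathfrak a\sqcup\!\sqcup1=\mathfrak a$ and, for nonempty $\mathfrak a=x_{a,\alpha}\mathfrak a_-$, $\mathfrak b=x_{b,\beta}\mathfrak b_-$: $\mathfrak a\diamond\mathfrak b=x_{a+b,\alpha\beta}(\mathfrak a_-\sqcup\!\sqcup\mathfrak b_-)+\sum_{i+j=a+b}\Delta^j_{a,b}x_{i,\alpha\beta}(x_j\sqcup\!\sqcup(\mathfrak a_-\sqcup\!\sqcup\mathfrak b_-))$, $\mathfrak a\sqcup\!\sqcup\mathfrak b=x_{a,\alpha}(\mathfrak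 a_-\sqcup\!\sqcup\mathfrak b)+x_{b,\beta}(\mathfrak a\sqcup\!\sqcup\mathfrak b_-)+\mathfrak a\diamond\mathfrak b$. For a word $\mathfrak a=x_{i_1}\cdots x_{i_m}$ with all characters $1$ put $[\mathfrak a]=(-1)^m\Delta^{i_1}_{1,w(\mathfrak a)+1}\cdots\Delta^{i_m}_{1,w(\mathfrak a)+1}x_{i_1}\sqcup\!\sqcup\cdots\sqcup\!\sqcup x_{i_m}$, $[1]=1$. The coproduct $\Delta:\mathfrak D\to\mathfrak D\otimes\mathfrak D$ is linear with $\Delta(1)=1\otimes1$, $\Delta(x_{n,\varepsilon})=1\otimes x_{n,\varepsilon}+\sum_{r\ge1,\ r+w(\mathfrak a)=n}\binom{r+\mathrm{depth}(\mathfrak a)-2}{\mathrm{depth}(\mathfrak a)}x_{r,\varepsilon}\otimes[\mathfrak a]$ (sum over words $\mathfrak a$ with all characters $1$), and for $\mathfrak u=x_{u,\varepsilon}\mathfrak v$ of depth $\ge2$, writing $\Delta(x_{u,\varepsilon})=1\otimes x_{u,\varepsilon}+\sum a\otimes b$ and $\Delta(\mathfrak v)=\sum a_{\mathfrak v}\otimes b_{\mathfrak v}$, $\Delta(\mathfrak u)=1\otimes\mathfrak u+\sum(a\,a_{\mathfrak v})\otimes(b\sqcup\!\sqcup b_{\mathfrak v})$. On $\mathfrak D\otimes\mathfrak D$, $(a\otimes b)\sqcup\!\sqcup(c\otimes d)=(a\sqcup\!\sqcup c)\otimes(b\sqcup\!\sqcup d)$. *)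

(* Defs.v *)
From HB Require Import structures.
From mathcomp Require Import all_boot all_order all_algebra all_field.
Set Implicit Arguments. Unset Strict Implicit. Unset Printing Implicit Defensive.
Import GRing.Theory.
Local Open Scope ring_scope.

(* The base field F_q is an arbitrary finite field F, q := #|F|.
   A letter x_{n,eps} is the pair (n, eps) : nat * F (validity n >= 1,
   eps <> 0 is imposed as a hypothesis on the words considered).
   A word is a seq of letters (empty word = [::] = 1).
   An element of the F-vector space D with basis the words is represented
   by a finite formal linear combination  seq (F * word); similarly for
   D (x) D and D (x) D (x) D with basis pairs/triples of words.  Two such
   representations denote the same vector iff all coefficients agree
   (coef3 below). *)

Section Defs.
Variable F : finFieldType.

Definition letter := (nat * F)%type.
Definition word := seq letter.
Definition lc := seq (F * word).
Definition lc2 := seq (F * (word * word)).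
Definition lc3 := seq (F * (word * word * word)).

Definition wt (w : word) : nat := sumn (map fst w).
Definition qF : nat := #|F|.

Definition DeltaC (r s j : nat) : F :=
  if (qF.-1 %| j)%N
  then (-1) ^+ r.-1 *+ 'C(j.-1, r.-1) + (-1) ^+ s.-1 *+ 'C(j.-1, s.-1)
  else 0.

Definition xn (n : nat) : letter := (n, 1).
Definition scale_lc (c : F) (X : lc) : lc := [seq (c * p.1, p.2) | p <- X].
Definition pre (l : letter) (X : lc) : lc := [seq (p.1, l :: p.2) | p <- X].
Definition ext (f : word -> lc) (X : lc) : lc :=
  flatten [seq scale_lc p.1 (f p.2) | p <- X].

(* prodf k true = shuffle, prodf k false = diamond, computed with fuel k
   (the recursion terminates on the measure 2*(total depth) (+1 for the
   shuffle); the top-level fuel below is always sufficient). *)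
Fixpoint prodf (k : nat) (sh : bool) (a b : word) {struct k} : lc :=
  match k with
  | 0 => [::]
  | k'.+1 =>
    match a, b with
    | [::], _ => [:: (1, b)]
    | _, [::] => [:: (1, a)]
    | (na, al) :: a', (nb, be) :: b' =>
      if sh then
        pre (na, al) (prodf k' true a' b) ++ pre (nb, be) (prodf k' true a b')
          ++ prodf k' false a b
      else
        let c := prodf k' true a' b' in
        pre (na + nb, al * be) c ++
        flatten [seq scale_lc (DeltaC na nb j)
                   (pre ((na + nb - j)%N, al * be)
                      (ext (prodf k' true [:: xn j]) c))
                | j <- iota 1 (na + nb).-1]
    end
  end.

Definition fuel (a b : word) : nat := (2 * (size a + size b)).+2.
Definition shuffle (a b : word) : lc := prodf (fuel a b) true a b.
Definition diamond (a b : word) : lc := prodf (fuel a b) false a b.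
Definition shuffle_lc (X Y : lc) : lc :=
  flatten [seq scale_lc p.1 (ext (shuffle p.2) Y) | p <- X].

(* [a] for a word a all of whose characters are 1 *)
Definition bracket (a : word) : lc :=
  scale_lc ((-1) ^+ size a * \prod_(l <- a) DeltaC 1 (wt a).+1 l.1)
    (foldr (fun l acc => shuffle_lc [:: (1, [:: l])] acc) [:: (1, [::])] a).

Fixpoint comps_aux (k m : nat) : seq (seq nat) :=
  if m is 0 then [:: [::]] else
  match k with
  | 0 => [::]
  | k'.+1 => flatten [seq [seq i :: s | s <- comps_aux k' (m - i)] | i <- iota 1 m]
  end.
Definition comps (m : nat) : seq (seq nat) := comps_aux m m.
Definition words1 (m : nat) : seq word := map (map xn) (comps m).

Definition cop_letter_red (l : letter) : lc2 :=
  flatten [seq flatten [seq [seq ('C((r + size w).-2, size w)%:R * p.1,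
                                   ([:: (r, l.2)], p.2)) | p <- bracket w]
                       | w <- words1 (l.1 - r)]
          | r <- iota 1 l.1].
Definition cop_letter (l : letter) : lc2 := (1, ([::], [:: l])) :: cop_letter_red l.

Fixpoint coprod (u : word) : lc2 :=
  match u with
  | [::] => [:: (1, ([::], [::]))]
  | l :: v =>
    if v is [::] then cop_letter l else
    (1, ([::], u)) ::
    flatten [seq flatten [seq [seq (p.1 * q.1 * s.1, (p.2.1 ++ q.2.1, s.2))
                              | s <- shuffle p.2.2 q.2.2]
                         | q <- coprod v]
            | p <- cop_letter_red l]
  end.

Definition id_tens_cop (X : lc2) : lc3 :=
  flatten [seq [seq (p.1 * q.1, (p.2.1, q.2.1, q.2.2)) | q <- coprod p.2.2] | p <- X].
Definition cop_tens_id (X : lc2) : lc3 :=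
  flatten [seq [seq (p.1 * q.1, (q.2.1, q.2.2, p.2.2)) | q <- coprod p.2.1] | p <- X].

Definition coef3 (X : lc3) (t : word * word * word) : F :=
  \sum_(p <- X) (if p.2 == t then p.1 else 0).

Definition in_Gamma_word (u : word) : bool :=
  all (fun l : letter => (0 < l.1)%N && (l.2 != 0)) u.

End Defs.

(* Main.v *)
Require Import Defs.
From mathcomp Require Import all_boot all_order all_algebra all_field.
From mathcomp Require Import ring zify.
Set Implicit Arguments. Unset Strict Implicit. Unset Printing Implicit Defensive.
Import GRing.Theory.
Local Open Scope ring_scope.

(* Words are evaluated in an algebraically closed field K containing F.  For a
   flag T = (t_1, k_1), ..., (t_d, k_d) with t_i outside V_i, the F-span of
   t_1, ..., t_(i-1), the word x_(n,eps) w is sent to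
   sum_i eps^k_i S_i(n) ev_(T_<i)(w), where S_i(n) = sum_(v in V_i) (t_i + v)^-n,
   a truncated multiple zeta value.  Partial fractions turn products of such sums
   into the shuffle product.  If g is the normalized F-linear polynomial vanishing
   on the span of T, then sum_v 1 / (t + v - h) = 1 / (g t - g h); comparing
   powers of h shows that the coproduct is dual to concatenation of flags:
   ev_(T T')(u) = sum ev_(g T')(u_1) ev_T(u_2).  Both sides of coassociativity
   thus evaluate to ev_(T T' T'')(u), because g_(T T') = g_(g_T T') o g_T, and
   evaluations at flags separate the elements of the word space. *)

(** * Power sums over a finite field *)

Section FiniteField.
Variable F : finFieldType.
Local Notation q := (qF F).

Lemma card_gt1 : (1 < q)%N.
Proof. exact: finNzRing_gt1. Qed.

Lemma predq_gt0 : (0 < q.-1)%N.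
Proof. by have := card_gt1; case: q => [|[]]. Qed.

Lemma predqK : q.-1.+1 = q.
Proof. by have := card_gt1; case: q. Qed.

Lemma card_prime_power (R : comNzRingType) (f : {rmorphism F -> R}) :
  exists p k, [/\ p \in [pchar R], (0 < k)%N & q = (p ^ k)%N].
Proof.
have [p p_pr pF] := finPcharP F.
have /p_natP[k qE] : p.-nat q.
  by rewrite /qF -cardsT; exact: (pprimeChar_pgroup pF).
exists p, k; split => //; first by rewrite (rmorph_pchar f).
by case: k qE card_gt1 => // ->.
Qed.

Lemma pnat_card (R : comNzRingType) (f : {rmorphism F -> R}) : [pchar R].-nat q.
Proof.
have [p [k [pR k0 ->]]] := card_prime_power f.
by rewrite (eq_pnat _ (pcharf_eq pR)) pnatX pnat_id // (pcharf_prime pR).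
Qed.

Lemma natr_card (R : comNzRingType) (f : {rmorphism F -> R}) : q%:R = 0 :> R.
Proof.
have [p [k [pR k0 ->]]] := card_prime_power f.
by case: k k0 => // k _; rewrite natrX exprS (pcharf0 pR) mul0r.
Qed.

Lemma natr_cardF : q%:R = 0 :> F.
Proof. exact: (@natr_card F idfun). Qed.

Lemma expf_predq (c : F) : c != 0 -> c ^+ q.-1 = 1.
Proof.
move=> c0; apply: (mulfI c0).
by rewrite -exprS predqK expf_card mulr1.
Qed.

Lemma expf_dvd (c : F) m : c != 0 -> (q.-1 %| m)%N -> c ^+ m = 1.
Proof.
by move=> c0 /dvdnP[k ->]; rewrite mulnC exprM expf_predq // expr1n.
Qed.

(** If the remainder r of m modulo q - 1 were positive, X^r - 1 would have q - 1 roots, more than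
    its degree. *)
Lemma expf_eq1_dvd m : (forall c : F, c != 0 -> c ^+ m = 1) -> (q.-1 %| m)%N.
Proof.
move=> H; rewrite /dvdn; case: posnP => // r0.
set r := (m %% q.-1)%N in r0 *.
have Hr (c : F) : c != 0 -> c ^+ r = 1.
  move=> c0; have := H c c0; rewrite (divn_eq m q.-1) exprD.
  by rewrite expf_dvd ?dvdn_mull // mul1r.
have p0 : 'X^r - 1 != 0 :> {poly F} by rewrite -size_poly_eq0 size_XnsubC.
pose s := enum (predC1 (0 : F)).
have := @max_poly_roots _ _ s p0.
rewrite size_XnsubC // -cardE cardC1 enum_uniq.
have -> : all (root ('X^r - 1 : {poly F})) s.
  apply/allP => c; rewrite mem_enum !inE => c0.
  by rewrite /root !hornerE Hr // subrr.
move=> /(_ isT isT); rewrite ltnS leqNgt ltn_mod.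
by have := predq_gt0; rewrite /qF => ->.
Qed.

(** Either every term is 1 and q - 1 = -1 in F, or scaling by some a with a^m different from 1
    forces the sum to vanish. *)
Lemma sum_units_exp m :
  \sum_(c : F | c != 0) c ^+ m = - ((q.-1 %| m)%N)%:R.
Proof.
have [d|nd] := boolP (q.-1 %| m)%N.
  rewrite (eq_bigr (fun=> 1)); last by move=> c c0; exact: expf_dvd.
  rewrite sumr_const (@eq_card _ _ (predC1 0)) // cardC1 -/(qF F).
  apply/eqP; rewrite -subr_eq0 opprK -[_ *+ _ + _]natrD addn1 predqK.
  by rewrite natr_cardF.
have [|[a [a0 am]]] : (forall c : F, c != 0 -> c ^+ m = 1) \/
   (exists a : F, a != 0 /\ a ^+ m != 1).
- case: (pickP (fun c : F => (c != 0) && (c ^+ m != 1))) => [a /andP[]|H].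
    by right; exists a.
  by left=> c c0; have := H c; rewrite /= c0 => /negbFE/eqP.
- by move/expf_eq1_dvd => d; rewrite d in nd.
rewrite oppr0; apply/eqP.
set S := \sum_(_ | _) _.
have E : S = a ^+ m * S.
  rewrite {1}/S (reindex_inj (mulfI a0)) /= mulr_sumr.
  apply: eq_big => [c|c _]; first by rewrite mulf_eq0 (negbTE a0).
  by rewrite exprMn.
have : (1 - a ^+ m) * S = 0 by rewrite mulrBl mul1r -E subrr.
by move/eqP; rewrite mulf_eq0 subr_eq0 eq_sym (negbTE am).
Qed.

Lemma sum_units_expV m :
  \sum_(c : F | c != 0) c ^- m = - ((q.-1 %| m)%N)%:R.
Proof.
rewrite -sum_units_exp (reindex_inj (@invr_inj F)) /=.
by apply: eq_big => [c|c _]; rewrite ?invr_eq0 // exprVn invrK.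
Qed.

Lemma big1_card (R : comNzRingType) : \sum_(c : F) (1 : R) = q%:R.
Proof. by rewrite big_const iter_addr_0; congr (_ *+ _); exact: eq_card. Qed.

Lemma sum_exp m : (m <= q.-1)%N ->
  \sum_(c : F) c ^+ m = - ((m == q.-1)%N)%:R.
Proof.
case: m => [|m] mq.
  (* For m = 0 the term 0^0 = 1 is counted, so the sum is q = 0. *)
  under eq_bigr do rewrite expr0.
  rewrite big1_card natr_cardF.
  by have := predq_gt0; case: q.-1 => //= n _; rewrite oppr0.
rewrite (bigD1 0) //= expr0n /= add0r sum_units_exp.
have -> // : (q.-1 %| m.+1)%N = (m.+1 == q.-1).
by apply/idP/eqP => [/dvdn_leq|->//] H; apply/eqP; rewrite eqn_leq mq H.
Qed.

(** After binomial expansion only the top power of c survives summation over F. The terms form a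
    partition of unity by the cofactors of [artin_factor]. *)
Lemma sum_shift_exp (R : comNzRingType) (f : {rmorphism F -> R}) (s : R) :
  \sum_(c : F) (1 - (s + f c) ^+ q.-1) = 1.
Proof.
rewrite sumrB big1_card natr_card // sub0r.
under eq_bigr do rewrite exprDn.
rewrite exchange_big /= (bigD1 ord_max) //= [X in _ + X]big1 => [|i].
  under eq_bigr do rewrite subnn expr0 mul1r binn mulr1n -rmorphXn /=.
  by rewrite -rmorph_sum sum_exp // eqxx rmorphN1 addr0 opprK.
rewrite -val_eqE /= => iq.
under eq_bigr do rewrite -rmorphXn /= -mulrnAl.
by rewrite -mulr_sumr -rmorph_sum sum_exp ?leq_ord // (negbTE iq) oppr0 rmorph0 mulr0.
Qed.

End FiniteField.
(** * Congruences of polynomials modulo a power of X *)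

Section TruncatedSeries.
Variable K : fieldType.
Implicit Types (p r d : {poly K}) (N : nat).

Definition eqm N p r := exists d, p = r + d * 'X^N.

Lemma eqm_refl N p : eqm N p p.
Proof. by exists 0; rewrite mul0r addr0. Qed.

Lemma eqm_sym N p r : eqm N p r -> eqm N r p.
Proof. by case=> d ->; exists (- d); ring. Qed.

Lemma eqm_trans N p r s : eqm N p r -> eqm N r s -> eqm N p s.
Proof. by case=> d -> [e ->]; exists (d + e); ring. Qed.

Lemma eqmD N p r p' r' : eqm N p r -> eqm N p' r' -> eqm N (p + p') (r + r').
Proof. by case=> d -> [e ->]; exists (d + e); ring. Qed.

Lemma eqmMl N s p r : eqm N p r -> eqm N (s * p) (s * r).
Proof. by case=> d ->; exists (s * d); ring. Qed.

Lemma eqm_sum N (I : Type) (r : seq I) (P : pred I) (f g : I -> {poly K}) :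
  (forall i, P i -> eqm N (f i) (g i)) ->
  eqm N (\sum_(i <- r | P i) f i) (\sum_(i <- r | P i) g i).
Proof.
move=> fg; apply: (big_ind2 (eqm N)) => //; first exact: eqm_refl.
by move=> *; exact: eqmD.
Qed.

Lemma eqm_coef N p r i : eqm N p r -> (i < N)%N -> p`_i = r`_i.
Proof. by case=> d -> iN; rewrite coefD coefMXn iN addr0. Qed.

(** Inverses modulo X^N are unique, so a series is identified by exhibiting what it inverts. *)
Lemma eqm_inv_uniq N u p r : eqm N (u * p) 1 -> eqm N (u * r) 1 -> eqm N p r.
Proof.
move=> up ur; apply: (@eqm_trans _ _ (p * (u * r))).
  by apply: eqm_sym; rewrite -[X in eqm _ _ X]mulr1; exact: eqmMl.
have -> : p * (u * r) = r * (u * p) by ring.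
by rewrite -[X in eqm _ _ X]mulr1; exact: eqmMl.
Qed.

(* The truncated expansion of 1 / (c - y) in powers of y. *)
Definition ginv N (c : K) (y : {poly K}) : {poly K} :=
  \sum_(r < N) c ^- r.+1 *: y ^+ r.

(** The geometric sum telescopes, and the remainder is a multiple of y^N, hence of X^N because X
    divides y. *)
Lemma ginv_mul N c y1 (y := 'X * y1) : c != 0 ->
  eqm N ((c%:P - y) * ginv N c y) 1.
Proof.
move=> c0; exists (- (c ^- N *: y1 ^+ N)).
have cc : c%:P * (c^-1)%:P = 1 :> {poly K} by rewrite -polyCM mulfV.
have gE w : ginv N c w = (c^-1)%:P * \sum_(r < N) ((c^-1)%:P * w) ^+ r.
  rewrite mulr_sumr; apply: eq_bigr => r _.
  by rewrite exprMn mulrA -polyC_exp -polyCM mul_polyC exprVn exprS invfM.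
rewrite gE; have -> : c%:P - y = - (c%:P * ((c^-1)%:P * y - 1)).
  by rewrite mulrBr mulrA cc mul1r mulr1 opprB.
rewrite mulNr mulrACA cc mul1r -subrX1 opprB exprMn -polyC_exp exprVn.
by rewrite /y exprMn mul_polyC mulNr -scalerAl [y1 ^+ N * _]mulrC.
Qed.

End TruncatedSeries.

(** * Partial fractions *)

Section PartialFractions.
Variable K : fieldType.
Implicit Types A B C : K.

(** For N = a + b and C = A - B, this is the principal part at A = 0 of A^-(a+1) B^-(b+1), with C
    held constant. The binomials vanish for j < b, so the powers of 1/A stop at a + 1. *)
Definition pfrac A C N b : K :=
  \sum_(j < N.+1) ((-1) ^+ b.+1 *+ 'C(j, b)) * C ^- j.+1 * A ^- (N - j).+1.

Lemma pfracS A C N b :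
  pfrac A C N.+1 b.+1 = C^-1 * (pfrac A C N b.+1 - pfrac A C N b).
Proof.
rewrite /pfrac big_ord_recl /= bin0n mulr0n !mul0r add0r -sumrB mulr_sumr.
apply: eq_bigr => j _; rewrite /bump /= add1n subSS binS mulrnDr.
rewrite (exprSr C j.+1) invfM exprS mulNr mul1r mulNrn.
by ring.
Qed.

Lemma pfrac0S A C N :
  pfrac A C N.+1 0 = - (C^-1 * A ^- N.+2) + C^-1 * pfrac A C N 0.
Proof.
rewrite /pfrac big_ord_recl /= bin0 subn0 expr1 mulr1n mulN1r mulNr.
congr (_ + _); rewrite mulr_sumr; apply: eq_bigr => j _.
rewrite /bump /= add1n subSS !bin0 (exprSr C j.+1) invfM.
by ring.
Qed.

Lemma pfrac_small A C N b : (N < b)%N -> pfrac A C N b = 0.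
Proof.
move=> Nb; rewrite /pfrac big1 // => j _.
by rewrite bin_small ?mulr0n ?mul0r // (leq_ltn_trans _ Nb) // -ltnS.
Qed.

Lemma partial_fraction0 A B b : A != 0 -> B != 0 -> A - B != 0 ->
  A ^-1 * B ^- b.+1 = pfrac A (A - B) b b + pfrac B (B - A) b 0.
Proof.
move=> A0 B0 C0; have C0' : B - A != 0 by rewrite subr_eq0 eq_sym -subr_eq0.
elim: b => [|b IH].
  rewrite /pfrac !big_ord_recl !big_ord0 /= !expr1 bin0 !mulr1n.
  by field; rewrite A0 B0 C0 C0'.
rewrite pfracS pfrac0S pfrac_small //.
have -> : (A - B)^-1 * (0 - pfrac A (A - B) b b) +
   (- ((B - A)^-1 / B ^+ b.+2) + (B - A)^-1 * pfrac B (B - A) b 0) =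
   (B - A)^-1 * (pfrac A (A - B) b b + pfrac B (B - A) b 0) -
   (B - A)^-1 / B ^+ b.+2.
  by rewrite -(opprB B A) invrN; ring.
rewrite -IH exprS; have Bb : B ^+ b.+1 != 0 by rewrite expf_neq0.
by field; rewrite A0 B0 C0' Bb.
Qed.

(** The identity 1/(AB) = (1/B - 1/A)/(A - B) lowers one exponent at a time; Pascal's rule in
    [pfracS] is the same recursion for the principal parts. *)
Lemma partial_fraction A B a b : A != 0 -> B != 0 -> A - B != 0 ->
  A ^- a.+1 * B ^- b.+1 =
  pfrac A (A - B) (a + b) b + pfrac B (B - A) (a + b) a.
Proof.
move=> A0 B0 C0; have C0' : B - A != 0 by rewrite subr_eq0 eq_sym -subr_eq0.
elim: a b => [|a IHa] b; first exact: partial_fraction0.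
elim: b => [|b IHb].
  by rewrite addn0 mulrC partial_fraction0 // addrC.
rewrite addnS (pfracS A _ (_ + _)%N) (pfracS B _ (_ + _)%N).
have -> : (A - B)^-1 * (pfrac A (A - B) (a.+1 + b) b.+1 -
    pfrac A (A - B) (a.+1 + b) b) +
  (B - A)^-1 * (pfrac B (B - A) (a.+1 + b) a.+1 -
    pfrac B (B - A) (a.+1 + b) a) =
  (A - B)^-1 * ((pfrac A (A - B) (a + b.+1) b.+1 + pfrac B (B - A) (a + b.+1) a)
   - (pfrac A (A - B) (a.+1 + b) b + pfrac B (B - A) (a.+1 + b) a.+1)).
  by rewrite -(opprB A B) invrN -addSnnS; ring.
rewrite -IHa -IHb !(exprS _ _.+1).
have Aa : A ^+ a.+1 != 0 by rewrite expf_neq0.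
have Bb : B ^+ b.+1 != 0 by rewrite expf_neq0.
by field; rewrite A0 B0 C0 Aa Bb.
Qed.

End PartialFractions.

(** * Evaluation of words at flags *)

Section Flags.
Variables (F : finFieldType) (K : fieldType) (inc : {rmorphism F -> K}).
Local Notation q := (qF F).

(* The head of the list is the last (topmost) step of the flag. *)
Definition flag := seq (K * nat).
Implicit Types (T : flag) (t : K).

Fixpoint span T : seq K :=
  if T is p :: T' then [seq inc c * p.1 + v | c <- enum F, v <- span T']
  else [:: 0].

(** The combinations whose topmost nonzero coefficient is 1: one representative for each line of
    nonzero combinations. *)
Fixpoint monics T : seq K :=
  if T is p :: T' then [seq p.1 + v | v <- span T'] ++ monics T' else [::].

(* The F-linear polynomial with linear coefficient 1 whose zeros are the span of
   T: the inverse of [sum_(v in span T) 1 / (X - v)]. *)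
Fixpoint gpol T : {poly K} :=
  if T is p :: T' then
    gpol T' - (gpol T').[p.1] ^- q.-1 *: gpol T' ^+ q
  else 'X.

Fixpoint good T : bool :=
  if T is p :: T' then ((gpol T').[p.1] != 0) && good T' else true.

Definition psum T t n : K := \sum_(v <- span T) (t + v) ^- n.

(** * Spans of flags and their additive polynomials *)

Lemma big_span_cons p T (f : K -> K) :
  \sum_(v <- span (p :: T)) f v =
  \sum_(c : F) \sum_(v <- span T) f (inc c * p.1 + v).
Proof. by rewrite /= big_allpairs_dep big_enum. Qed.

Lemma gpol_cons p T x : (gpol (p :: T)).[x] =
  (gpol T).[x] - (gpol T).[p.1] ^- q.-1 * (gpol T).[x] ^+ q.
Proof. by rewrite /= !hornerE. Qed.

Lemma gpolD T x y : (gpol T).[x + y] = (gpol T).[x] + (gpol T).[y].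
Proof.
elim: T => [|p T IH]; first by rewrite !hornerE.
rewrite !gpol_cons IH exprDn_pchar; first by ring.
exact: (pnat_card inc).
Qed.

Lemma gpolZ T c x : (gpol T).[inc c * x] = inc c * (gpol T).[x].
Proof.
elim: T => [|p T IH]; first by rewrite !hornerE.
by rewrite !gpol_cons IH exprMn -rmorphXn /= expf_card; ring.
Qed.

Lemma gpol0 T : (gpol T).[0] = 0.
Proof. by have := gpolZ T 0 0; rewrite rmorph0 !mul0r. Qed.

(** The coefficient in [gpol] is chosen so that z - z^-(q-1) z^q = 0 at the value z taken at the new
    step; its F-multiples are zeros too since c^q = c. *)
Lemma gpol_span T v : v \in span T -> (gpol T).[v] = 0.
Proof.
elim: T v => [|p T IH] v; first by rewrite inE => /eqP->; rewrite hornerX.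
move=> /allpairsP[[c w] /= [_ /IH wT ->]].
rewrite gpol_cons gpolD gpolZ wT addr0.
have [->|z0] := eqVneq (gpol T).[p.1] 0.
  by rewrite mulr0 -{2}(predqK F) exprS mul0r mulr0 subr0.
rewrite exprMn -rmorphXn /= expf_card -{2}(predqK F) exprSr.
by field; rewrite expf_neq0.
Qed.

Lemma good_nz T t v : (gpol T).[t] != 0 -> v \in span T -> t + v != 0.
Proof.
move=> t0 vT; apply: contra_neq t0 => tv.
by have := gpol0 T; rewrite -tv gpolD (gpol_span vT) addr0.
Qed.

Lemma monics_nz T m : good T -> m \in monics T -> m != 0.
Proof.
elim: T => [|p T IH] //= /andP[p0 gT]; rewrite mem_cat => /orP[|/(IH gT)//].
by case/mapP=> v vT ->; exact: good_nz vT.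
Qed.

(** Translation by v permutes the span. As the span is a list of combinations, this is carried out
    one coefficient at a time. *)
Lemma big_span_shift T (f : K -> K -> K) :
  \sum_(v <- span T) \sum_(w <- span T) f v (v + w) =
  \sum_(v <- span T) \sum_(w <- span T) f v w.
Proof.
elim: T f => [|p T IH] f; first by rewrite /= !big_seq1 addr0.
rewrite !big_span_cons; apply: eq_bigr => c _.
under eq_bigr do rewrite big_span_cons.
under [RHS]eq_bigr do rewrite big_span_cons.
rewrite exchange_big [RHS]exchange_big /=.
rewrite [RHS](reindex_inj (addrI c)) /=; apply: eq_bigr => d _.
rewrite -[RHS](IH (fun v w => f (inc c * p.1 + v) (inc (c + d) * p.1 + w))).
apply: eq_bigr => v _; apply: eq_bigr => w _.
by congr f; rewrite rmorphD /=; ring.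
Qed.

Lemma big_span_scale T c (f : K -> K) : c != 0 ->
  \sum_(v <- span T) f (inc c * v) = \sum_(v <- span T) f v.
Proof.
move=> c0; elim: T f => [|p T IH] f; first by rewrite /= !big_seq1 mulr0.
rewrite !big_span_cons [RHS](reindex_inj (mulfI c0)) /=.
apply: eq_bigr => d _; rewrite -(IH (fun v => f (_ + v))).
by apply: eq_bigr => v _; rewrite rmorphM /= mulrDr mulrA.
Qed.

(** A combination c p + v with c nonzero equals c (p + v') after rescaling v, which leaves sums over
    the lower span unchanged. *)
Lemma big_span_monics T (f : K -> K) :
  \sum_(v <- span T) f v =
  f 0 + \sum_(m <- monics T) \sum_(c : F | c != 0) f (inc c * m).
Proof.
elim: T => [|p T IH]; first by rewrite /= big_seq1 big_nil addr0.
rewrite big_span_cons (bigD1 0) //= big_cat big_map /= addrCA addrC -IH.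
congr (_ + _); last first.
  by apply: eq_bigr => v _; rewrite rmorph0 mul0r add0r.
rewrite [RHS]exchange_big /=; apply: eq_bigr => c c0.
rewrite -(big_span_scale T (fun v => f (_ + v)) c0).
by apply: eq_bigr => v _; rewrite mulrDr.
Qed.

(** Each line of nonzero vectors contributes the sum of c^-j over the units of F; this is the source
    of the condition (q - 1) | j in [DeltaC]. The zero vector contributes 0, as 0 is its own
    inverse. *)
Lemma psum0 T j : (0 < j)%N ->
  psum T 0 j = - ((q.-1 %| j)%N)%:R * \sum_(m <- monics T) m ^- j.
Proof.
case: j => // j _; rewrite /psum.
rewrite (eq_bigr (fun v => v ^- j.+1)) => [|v _]; last by rewrite add0r.
rewrite big_span_monics expr0n invr0 add0r mulr_sumr.
apply: eq_bigr => m _; rewrite -(rmorph_nat inc) -rmorphN -sum_units_expV.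
rewrite rmorph_sum mulr_suml; apply: eq_bigr => c _.
by rewrite exprMn invfM fmorphV rmorphXn.
Qed.

(** In the double sum over t + v and t + v + w, the diagonal w = 0 gives the first term. Off the
    diagonal, partial fractions separate the two factors, and the remaining sums over w are
    evaluated by [psum0]. This is the diamond product of two letters. *)
Lemma psum_mul T t a b : good T -> (gpol T).[t] != 0 ->
  psum T t a.+1 * psum T t b.+1 = psum T t (a + b).+2 +
  \sum_(j < (a + b).+1) inc (DeltaC F a.+1 b.+1 j.+1) *
     psum T t (a + b - j).+1 * \sum_(m <- monics T) m ^- j.+1.
Proof.
move=> gT t0; rewrite {1 2}/psum mulr_suml.
under eq_bigr do rewrite mulr_sumr.
rewrite -(big_span_shift T (fun v w => (t + v) ^- a.+1 * (t + w) ^- b.+1)).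
have E v w : v \in span T -> w \in span T ->
   (t + v) ^- a.+1 * (t + (v + w)) ^- b.+1 =
   (w == 0)%:R * (t + v) ^- (a + b).+2 +
   (pfrac (t + v) (- w) (a + b) b + pfrac (t + (v + w)) w (a + b) a).
  move=> vT wT; have A0 := good_nz t0 vT.
  have B0 : t + (v + w) != 0.
    by rewrite addrA (@good_nz T) // gpolD (gpol_span vT) addr0.
  have [->|w0] := eqVneq w 0.
    (* At w = 0 both principal parts vanish by the convention 1 / 0 = 0. *)
    rewrite !addr0 mul1r /pfrac !big1 ?addr0 => [|j _|j _].
    - by rewrite -invfM -exprD addSn addnS.
    - by rewrite (expr0n K j.+1) invr0 mulr0 mul0r.
    - by rewrite oppr0 (expr0n K j.+1) invr0 mulr0 mul0r.
  have C0 : t + v - (t + (v + w)) = - w by ring.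
  rewrite mul0r add0r partial_fraction ?C0 ?oppr_eq0 //.
  by congr (_ + pfrac _ _ _ _); ring.
rewrite (eq_big_seq (fun v => \sum_(w <- span T) ((w == 0)%:R * (t + v) ^- (a + b).+2 +
   (pfrac (t + v) (- w) (a + b) b + pfrac (t + (v + w)) w (a + b) a)))); last first.
  by move=> v vT; apply: eq_big_seq => w wT; exact: E.
under eq_bigr do rewrite !big_split /=.
rewrite !big_split /=; congr (_ + _).
  rewrite /psum; apply: eq_bigr => v _; rewrite -mulr_suml big_span_monics eqxx.
  rewrite big_seq big1 ?addr0 ?mul1r // => m mT; apply: big1 => c c0.
  by rewrite mulf_eq0 fmorph_eq0 (negbTE c0) (negbTE (monics_nz gT mT)).
rewrite [X in _ + X]exchange_big /=.
rewrite [X in _ + X](eq_bigr (fun w =>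
  \sum_(v <- span T) pfrac (t + (w + v)) w (a + b) a)); last first.
  by move=> w _; apply: eq_bigr => v _; rewrite (addrC v).
rewrite (big_span_shift T (fun w v => pfrac (t + v) w (a + b) a)).
(* The scalar [e] will be -1 and 1, covering both principal parts; scaling invariance of the span
   then removes it. *)
have Epf N e d : \sum_(w <- span T) \sum_(v <- span T) pfrac (t + v) (inc e * w) N d =
    \sum_(j < N.+1) ((-1) ^+ d.+1 *+ 'C(j, d)) *
      (\sum_(w <- span T) (inc e * w) ^- j.+1) * psum T t (N - j).+1.
  rewrite /pfrac; under eq_bigr do rewrite exchange_big /=.
  rewrite exchange_big /=; apply: eq_bigr => j _.
  rewrite [X in X * psum _ _ _]mulr_sumr mulr_suml; apply: eq_bigr => w _.
  by rewrite [RHS]mulr_sumr.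
rewrite exchange_big /= (eq_bigr (fun w => \sum_(v <- span T)
   pfrac (t + v) (inc (-1) * w) (a + b) b)); last first.
  by move=> w _; rewrite rmorphN1 mulN1r.
rewrite [X in _ + X](eq_bigr (fun w => \sum_(v <- span T)
   pfrac (t + v) (inc 1 * w) (a + b) a)); last first.
  by move=> w _; rewrite rmorph1 mul1r.
rewrite !Epf -big_split; apply: eq_bigr => j _ /=.
rewrite !(big_span_scale T (fun w => w ^- j.+1)) ?oppr_eq0 ?oner_eq0 //.
have -> : \sum_(w <- span T) w ^- j.+1 = psum T 0 j.+1.
  by apply: eq_bigr => w _; rewrite add0r.
(* The minus sign of [psum0] turns the (-1)^(b+1) of [pfrac] into the (-1)^b of [DeltaC], and
   likewise for a. *)
rewrite psum0 // /DeltaC; case: ifP => _; last first.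
  by rewrite mulr0n oppr0 rmorph0 !(mul0r, mulr0) addr0.
rewrite rmorphD !rmorphMn !rmorphXn !rmorphN1 /= !exprS.
by rewrite -[X in X * _ * _ + _]mulr_natr -[X in _ + X * _ * _]mulr_natr
     -[X in (X + _) * _ * _]mulr_natr -[X in (_ + X) * _ * _]mulr_natr; ring.
Qed.

(** * Generating series of power sums *)

Local Notation rho := (polyC \o inc).

(** This is [gpol T] divided by X. The coefficients of its powers are the sums over compositions
    found in the coproduct of a letter. *)
Fixpoint gquot T : {poly K} :=
  if T is p :: T' then
    gquot T' * (1 - (gpol T').[p.1] ^- q.-1 *: gpol T' ^+ q.-1)
  else 1.

Lemma gpolE T : gpol T = 'X * gquot T.
Proof.
elim: T => [|p T IH] /=; first by rewrite mulr1.
by rewrite mulrA -IH mulrBr mulr1 -scalerAr -exprS predqK.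
Qed.

Lemma gquot0 T : (gquot T)`_0 = 1.
Proof.
rewrite -horner_coef0; elim: T => [|p T IH] /=; first by rewrite hornerC.
rewrite hornerM IH mul1r !hornerE gpol0 expr0n.
by case: q.-1 (predq_gt0 F) => // n _; rewrite mulr0 subr0.
Qed.

Lemma frobeniusD (P R : {poly K}) : (P + R) ^+ q = P ^+ q + R ^+ q.
Proof. exact: exprDn_pchar (pnat_card rho). Qed.

(** With s = P / z the left side is z (s - s^q), and the Artin-Schreier expression s - s^q is
    unchanged when s is replaced by s + c. *)
Lemma artin_factor (P : {poly K}) z c : z != 0 ->
  P - z ^- q.-1 *: P ^+ q =
  (1 - (z^-1 *: P + rho c) ^+ q.-1) * (P + (inc c * z)%:P).
Proof.
move=> z0; have zz : z%:P * (z^-1)%:P = 1 :> {poly K} by rewrite -polyCM mulfV.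
set s := z^-1 *: P.
have -> : P = z%:P * s by rewrite /s -mul_polyC mulrA zz mul1r.
have -> : z%:P * s + (inc c * z)%:P = z%:P * (s + rho c).
  by rewrite polyCM mulrDr /= mulrC; ring.
have -> : (1 - (s + rho c) ^+ q.-1) * (z%:P * (s + rho c)) =
  z%:P * ((s + rho c) - (s + rho c) ^+ q).
  by rewrite -{2}(predqK F) exprSr; ring.
rewrite frobeniusD -rmorphXn /= expf_card.
rewrite exprMn -mul_polyC -{2}(predqK F) exprSr -polyC_exp.
have zq : (z ^- q.-1)%:P * (z ^+ q.-1)%:P = 1 :> {poly K}.
  by rewrite -polyCM mulVf // expf_neq0.
transitivity (z%:P * s - ((z ^- q.-1)%:P * (z ^+ q.-1)%:P) * z%:P * s ^+ q).
  by ring.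
by rewrite zq; ring.
Qed.

(** Each x + c z - y divides g(x) - g(y), for g(X) = X - z^-(q-1) X^q, with the cofactor of
    [artin_factor]. These cofactors sum to 1, so the sum of the inverses inverts g(x) - g(y). *)
Lemma ginv_sum N z x (y y1 : {poly K}) : y = 'X * y1 ->
  z != 0 -> (forall c, x + inc c * z != 0) ->
  x - z ^- q.-1 * x ^+ q != 0 ->
  eqm N (\sum_(c : F) ginv N (x + inc c * z) y)
    (ginv N (x - z ^- q.-1 * x ^+ q) (y - z ^- q.-1 *: y ^+ q)).
Proof.
move=> yE z0 xz0 gx0.
set c0 := x - _; set y0 := y - _.
have y0E : exists y2 : {poly K}, y0 = 'X * y2.
  exists (y1 - z ^- q.-1 *: (y1 * y ^+ q.-1)).
  by rewrite /y0 mulrBr -scalerAr mulrA -yE -exprS predqK.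
apply: (@eqm_inv_uniq _ _ (c0%:P - y0)); last first.
  by case: y0E => y2 ->; exact: ginv_mul.
have UE c : c0%:P - y0 =
    (1 - (z^-1 *: (x%:P - y) + rho c) ^+ q.-1) * ((x + inc c * z)%:P - y).
  have -> : (x + inc c * z)%:P - y = (x%:P - y) + (inc c * z)%:P.
    by rewrite polyCD; ring.
  rewrite -artin_factor // /c0 /y0 frobeniusD.
  rewrite (exprNn y).
  have -> : (-1) ^+ q = -1 :> {poly K}.
    by rewrite -(rmorphN1 rho) -rmorphXn /= expf_card.
  by rewrite polyCB polyCM polyC_exp -!mul_polyC; ring.
rewrite -[X in eqm _ _ X](sum_shift_exp rho (z^-1 *: (x%:P - y))) mulr_sumr.
apply: eqm_sum => c _; rewrite (UE c) -mulrA -[X in eqm _ _ X]mulr1.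
by apply: eqmMl; rewrite yE; exact: ginv_mul.
Qed.

Lemma mem0_span T : 0 \in span T.
Proof.
elim: T => [|p T IH]; first by rewrite inE.
apply/allpairsP; exists (0, 0) => /=.
by rewrite mem_enum inE IH rmorph0 mul0r addr0.
Qed.

Lemma gpol_cons_nz p T t c : (gpol (p :: T)).[t] != 0 ->
  (gpol T).[t + inc c * p.1] != 0.
Proof.
apply: contra_neq => tc0.
have : (gpol (p :: T)).[t + inc c * p.1] = 0.
  by rewrite gpol_cons tc0 expr0n -(predqK F) mulr0 subr0.
have pT : p.1 \in span (p :: T).
  apply/allpairsP; exists (1, 0) => /=.
  by rewrite mem_enum inE mem0_span rmorph1 mul1r addr0.
by rewrite gpolD gpolZ (gpol_span pT) mulr0 addr0.
Qed.

Lemma psum_cons p T t n :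
  psum (p :: T) t n = \sum_(c : F) psum T (t + inc c * p.1) n.
Proof.
rewrite /psum big_span_cons; apply: eq_bigr => c _.
by apply: eq_bigr => v _; rewrite addrA.
Qed.

(* Both sides expand sum_v 1 / (t + v - X) = 1 / (g t - g X), where g is the
   additive polynomial attached to T. *)
Lemma psum_series N T t : good T -> (gpol T).[t] != 0 ->
  eqm N (\sum_(n < N) psum T t n.+1 *: 'X^n) (ginv N (gpol T).[t] (gpol T)).
Proof.
elim: T t => [|p T IH] t.
  move=> _ _; rewrite /psum /ginv /= hornerX.
  by under eq_bigr do rewrite big_seq1 addr0; exact: eqm_refl.
move=> /andP[p0 gT] t0; rewrite gpol_cons.
have -> : \sum_(n < N) psum (p :: T) t n.+1 *: 'X^n =
    \sum_(c : F) \sum_(n < N) psum T (t + inc c * p.1) n.+1 *: 'X^n.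
  rewrite exchange_big; apply: eq_bigr => n _.
  by rewrite psum_cons scaler_suml.
apply: (@eqm_trans _ _ _
    (\sum_(c : F) ginv N ((gpol T).[t] + inc c * (gpol T).[p.1]) (gpol T))).
  apply: eqm_sum => c _; rewrite -gpolZ -gpolD; apply: IH => //.
  exact: gpol_cons_nz.
apply: (ginv_sum _ (gpolE T)) => //.
- by move=> c; rewrite -gpolZ -gpolD gpol_cons_nz.
- by rewrite -gpol_cons.
Qed.

(** The coefficient of X^n in [psum_series]. Power sums at t are thus polynomials in the inverse of
    g(t), which serves both the coproduct formula and the separation of words. *)
Lemma psum_expand T t n : good T -> (gpol T).[t] != 0 ->
  psum T t n.+1 = \sum_(r < n.+1) (gpol T ^+ r)`_n * (gpol T).[t] ^- r.+1.
Proof.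
move=> gT t0; have := eqm_coef (psum_series n.+1 gT t0) (ltnSn n).
rewrite !coef_sum (bigD1 ord_max) //= coefZ coefXn eqxx mulr1 big1 ?addr0.
  by move=> ->; apply: eq_bigr => r _; rewrite coefZ mulrC.
move=> i ni; rewrite coefZ coefXn (_ : (n == i) = false) ?mulr0 //.
by apply: contra_neqF ni => /eqP ni; exact/val_inj.
Qed.

(* The left factor is X * sum_(v in span T) 1 / (X - v); recall that 1 / 0 = 0 in
   [psum T 0]. *)
Lemma gquot_series N T : good T ->
  eqm N ((1 - 'X * \sum_(n < N) psum T 0 n.+1 *: 'X^n) * gquot T) 1.
Proof.
elim: T => [|p T IH] /=.
  move=> _; rewrite big1 => [|n _]; first by rewrite mulr0 subr0 mulr1; exact: eqm_refl.
  by rewrite /psum /= big_seq1 addr0 expr0n invr0 scale0r.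
move=> /andP[z0 gT]; set z := (gpol T).[p.1] in z0 *.
set h := 1 - z ^- q.-1 *: gpol T ^+ q.-1.
have -> : \sum_(n < N) psum (p :: T) 0 n.+1 *: 'X^n =
    \sum_(n < N) psum T 0 n.+1 *: 'X^n +
    \sum_(c : F | c != 0) \sum_(n < N) psum T (inc c * p.1) n.+1 *: 'X^n.
  rewrite exchange_big -big_split; apply: eq_bigr => n _ /=.
  rewrite psum_cons -scaler_suml -scalerDl (bigD1 0) //= rmorph0 mul0r add0r.
  by congr ((_ + _) *: _); apply: eq_bigr => c _; rewrite add0r.
set Q := \sum_(n < N) psum T 0 n.+1 *: 'X^n in IH *.
(* The vectors c p + v with c nonzero contribute truncated inverses of c z - g(X) by [psum_series];
   the old vectors give the induction hypothesis times [h]. *)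
apply: (@eqm_trans _ _ _ (h * ((1 - 'X * Q) * gquot T) +
   \sum_(c : F | c != 0) (- (gpol T * h)) * ginv N (inc c * z) (gpol T))).
  rewrite -mulr_sumr gpolE.
  have -> R : (1 - 'X * (Q + R)) * (gquot T * h) =
     h * ((1 - 'X * Q) * gquot T) + (- ('X * gquot T * h)) * R by ring.
  apply: eqmD; first exact: eqm_refl.
  apply: eqmMl; apply: eqm_sum => c c0.
  have := @psum_series N T (inc c * p.1) gT; rewrite gpolZ -/z -gpolE; apply.
  by rewrite mulf_neq0 // fmorph_eq0.
have N1 : (-1) ^+ q = -1 :> {poly K}.
  by rewrite -(rmorphN1 rho) -rmorphXn /= expf_card.
have N1' : (-1) ^+ q.-1 = 1 :> {poly K}.
  rewrite -(rmorphN1 rho) -rmorphXn /= expf_predq ?oppr_eq0 ?oner_eq0 //.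
  by rewrite !rmorph1.
(* The constant 1 is split into cofactors at s = - g / z: the one at c = 0 is [h], and the others
   arise from [artin_factor] applied to - g. *)
rewrite -[X in eqm _ _ X](sum_shift_exp rho (z^-1 *: - gpol T)).
rewrite [X in eqm _ _ X](bigD1 0) //=.
apply: eqmD.
  rewrite rmorph0 addr0 scalerN (exprNn (z^-1 *: _)) N1' mul1r exprZn exprVn -/h.
  by rewrite -[X in eqm _ _ X]mulr1; apply: eqmMl; exact: IH.
apply: eqm_sum => c c0.
have -> : - (gpol T * h) = - gpol T - z ^- q.-1 *: (- gpol T) ^+ q.
  rewrite (exprNn (gpol T)) N1 mulN1r scalerN opprK.
  rewrite /h mulrBr mulr1 -scalerAr -exprS predqK; ring.
rewrite (artin_factor _ c z0) -mulrA -[X in eqm _ _ X]mulr1; apply: eqmMl.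
rewrite addrC gpolE; apply: ginv_mul.
by rewrite mulf_neq0 // fmorph_eq0.
Qed.

(** Obtained from [gquot_series] times the k-th power of [gquot T], at degree m. *)
Lemma gquot_exp_rec T k m : good T -> (gquot T ^+ k.+1)`_m = (gquot T ^+ k)`_m +
  \sum_(i <- iota 1 m) psum T 0 i * (gquot T ^+ k.+1)`_(m - i).
Proof.
move=> gT; have /(@eqmMl _ _ (gquot T ^+ k)) := gquot_series m.+1 gT.
rewrite mulr1; set Q := \sum_(n < _) _ => /eqm_coef/(_ (ltnSn m)) <-.
have -> : gquot T ^+ k * ((1 - 'X * Q) * gquot T) =
   gquot T ^+ k.+1 - 'X * Q * gquot T ^+ k.+1 by rewrite exprSr; ring.
rewrite coefB -[LHS](subrK ('X * Q * gquot T ^+ k.+1)`_m); congr (_ + _).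
rewrite coefM big_ord_recl coefXM /= mul0r add0r.
have -> : iota 1 m = index_iota 1 m.+1 by rewrite /index_iota subSS subn0.
rewrite big_add1 big_mkord; apply: eq_bigr => i _.
rewrite /bump /= add1n coefXM /= coef_sum.
rewrite (bigD1 (widen_ord (leqnSn m) i)) //= coefZ coefXn eqxx mulr1.
rewrite big1 ?addr0 // => j ji; rewrite coefZ coefXn.
rewrite (_ : (_ == _) = false) ?mulr0 //.
by apply: contra_neqF ji => /eqP ij; exact/val_inj.
Qed.

Lemma big_iota1 (V : nmodType) n (f : nat -> V) :
  \sum_(j <- iota 1 n) f j = \sum_(j < n) f j.+1.
Proof.
have -> : iota 1 n = index_iota 1 n.+1 by rewrite /index_iota subSS subn0.
by rewrite big_add1 big_mkord.
Qed.

(** * Functionals on formal combinations of words *)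

Definition lin (E : word F -> K) (X : lc F) : K :=
  \sum_(p <- X) inc p.1 * E p.2.

Lemma lin1 E w : lin E [:: (1, w)] = E w.
Proof. by rewrite /lin big_seq1 rmorph1 mul1r. Qed.

Lemma lin_cat E X Y : lin E (X ++ Y) = lin E X + lin E Y.
Proof. exact: big_cat. Qed.

Lemma lin_scale E c X : lin E (scale_lc c X) = inc c * lin E X.
Proof.
rewrite /lin big_map mulr_sumr; apply: eq_bigr => p _ /=.
by rewrite rmorphM mulrA.
Qed.

Lemma lin_pre E l X : lin E (pre l X) = lin (fun w => E (l :: w)) X.
Proof. by rewrite /lin big_map. Qed.

Lemma lin_flatten E (I : Type) (r : seq I) (f : I -> lc F) :
  lin E (flatten [seq f i | i <- r]) = \sum_(i <- r) lin E (f i).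
Proof. by rewrite /lin big_flatten big_map. Qed.

Lemma lin_ext E f X : lin E (ext f X) = lin (fun w => lin E (f w)) X.
Proof. by rewrite lin_flatten; apply: eq_bigr => p _; rewrite lin_scale. Qed.

Lemma eq_lin (P : pred (word F)) E E' (X : lc F) :
  all (fun p => P p.2) X -> (forall w, P w -> E w = E' w) ->
  lin E X = lin E' X.
Proof.
move=> /allP XP EE; apply: eq_big_seq => p /XP pP.
by rewrite EE.
Qed.

Lemma linZ E c X : lin (fun w => c * E w) X = c * lin E X.
Proof. by rewrite /lin mulr_sumr; apply: eq_bigr => p _; rewrite mulrCA. Qed.

Definition posw (w : word F) := all (fun l => 0 < l.1)%N w.

(** The length bound controls the fuel when a word occurring in one product enters another. *)
Definition posn n (w : word F) := posw w && (size w <= n)%N.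

Lemma all_flatten (A : Type) (a : pred A) (ss : seq (seq A)) :
  all a (flatten ss) = all (all a) ss.
Proof. by elim: ss => //= s ss IH; rewrite all_cat IH. Qed.

Lemma all_scale (P : pred (word F)) c (X : lc F) :
  all (fun p => P p.2) (scale_lc c X) = all (fun p => P p.2) X.
Proof. by rewrite all_map. Qed.

Lemma all_ext (P Q : pred (word F)) f (X : lc F) :
  all (fun p => P p.2) X -> (forall w, P w -> all (fun p => Q p.2) (f w)) ->
  all (fun p => Q p.2) (ext f X).
Proof.
move=> /allP XP fQ; rewrite all_flatten all_map; apply/allP => p /XP pP.
by rewrite /= all_scale fQ.
Qed.

Lemma prodf_shuffleS k (l : letter F) a l' b :
  prodf k.+1 true (l :: a) (l' :: b) =
  pre l (prodf k true a (l' :: b)) ++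
  pre l' (prodf k true (l :: a) b) ++ prodf k false (l :: a) (l' :: b).
Proof. by case: l l' => [? ?] [? ?]. Qed.

Lemma prodf_diamondS k (l : letter F) a l' b :
  prodf k.+1 false (l :: a) (l' :: b) =
  pre ((l.1 + l'.1)%N, l.2 * l'.2) (prodf k true a b) ++
  flatten [seq scale_lc (DeltaC F l.1 l'.1 j)
                 (pre ((l.1 + l'.1 - j)%N, l.2 * l'.2)
                    (ext (prodf k true [:: xn F j]) (prodf k true a b)))
          | j <- iota 1 (l.1 + l'.1).-1].
Proof. by case: l l' => [? ?] [? ?]. Qed.

(** The diamond merges two letters into one and adds back at most the letter x_j, so lengths never
    exceed the sum. Exhausted fuel gives the empty combination, so every [k] is allowed. *)
Lemma prodf_posn k sh a b : posw a -> posw b ->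
  all (fun p => posn (size a + size b) p.2) (prodf k sh a b).
Proof.
elim: k sh a b => [|k IH] sh [|[na al] a] [|[nb be] b] // pa pb.
- by rewrite [prodf _ _ _ _]/= all_seq1 /posn pb leqnn.
- by rewrite [prodf _ _ _ _]/= all_seq1 /posn pa addn0 leqnn.
have [/andP[na0 pa'] /andP[nb0 pb']] := (pa, pb).
have all_pre n l (X : lc F) : (0 < l.1)%N -> all (fun p => posn n p.2) X ->
    all (fun p => posn n.+1 p.2) (pre l X).
  move=> l0 /allP H; rewrite all_map; apply/allP => p /H.
  by rewrite /posn /= l0.
have weaken n n' (X : lc F) : (n <= n')%N -> all (fun p => posn n p.2) X ->
    all (fun p => posn n' p.2) X.
  by move=> nn'; apply: sub_all => p /andP[pp sp]; rewrite /posn pp (leq_trans sp).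
case: sh; rewrite ?prodf_shuffleS ?prodf_diamondS.
  rewrite !all_cat; apply/and3P; split.
  - by apply: all_pre => //; have := IH true a ((nb, be) :: b) pa' pb.
  - rewrite addnC; apply: all_pre => //.
    by have := IH true ((na, al) :: a) b pa pb'; rewrite addnC.
  - exact: IH.
rewrite all_cat; apply/andP; split.
  apply: (weaken (size a + size b).+1); first by rewrite /= addSn addnS leqW.
  by apply: all_pre; [rewrite addn_gt0 na0 | exact: IH].
rewrite all_flatten all_map; apply/allP => j; rewrite mem_iota => jn.
rewrite /= all_scale; apply: (weaken (size a + size b).+2); first by rewrite addSn addnS.
apply: all_pre; first by move: jn na0 nb0 => /=; lia.
apply: (@all_ext (posn (size a + size b))); first exact: IH.
move=> w /andP[pw sw]; apply: (weaken (1 + size w)%N) => //.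
by apply: IH => //; rewrite /= andbT; case/andP: jn.
Qed.

(** * Evaluation at a flag is multiplicative for the shuffle *)

Fixpoint ev T (w : word F) {struct T} : K :=
  match T, w with
  | _, [::] => 1
  | [::], _ :: _ => 0
  | p :: T', l :: w' =>
      ev T' w + inc l.2 ^+ p.2 * psum T' p.1 l.1 * ev T' w'
  end.

Definition strip (p : K * nat) T (w : word F) : K :=
  if w is l :: w' then inc l.2 ^+ p.2 * psum T p.1 l.1 * ev T w' else 0.

Lemma ev_nil T : ev T [::] = 1.
Proof. by case: T. Qed.

Lemma ev_cons p T w : ev (p :: T) w = ev T w + strip p T w.
Proof. by case: w => [|l w] //=; rewrite ev_nil addr0. Qed.

Lemma lin_ev_cons p T X :
  lin (ev (p :: T)) X = lin (ev T) X + lin (strip p T) X.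
Proof.
by rewrite -big_split; apply: eq_bigr => x _; rewrite ev_cons mulrDr.
Qed.

Lemma lin_strip_pre p T l X :
  lin (strip p T) (pre l X) =
  inc l.2 ^+ p.2 * psum T p.1 l.1 * lin (ev T) X.
Proof. by rewrite lin_pre linZ. Qed.

(** This turns the sums over monic vectors in [psum0] and [psum_mul] into evaluations of the letters
    x_n. *)
Lemma ev_letter1 T n : ev T [:: xn F n] = \sum_(m <- monics T) m ^- n.
Proof.
elim: T => [|p T IH]; first by rewrite big_nil.
rewrite ev_cons IH /= big_cat big_map /= rmorph1 expr1n mul1r ev_nil mulr1.
by rewrite addrC.
Qed.

Lemma lin_ev0_prodf k sh l a l' b :
  lin (ev [::]) (prodf k sh (l :: a) (l' :: b)) = 0.
Proof.
have H0 l1 X : lin (ev [::]) (pre l1 X) = 0.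
  by rewrite lin_pre /lin big1 // => p _; rewrite mulr0.
elim: k sh => [|k IH] sh; first by rewrite /lin /= big_nil.
case: sh; rewrite ?prodf_shuffleS ?prodf_diamondS !lin_cat !H0 ?IH ?addr0 // add0r.
by rewrite lin_flatten big1 // => j _; rewrite lin_scale H0 mulr0.
Qed.

(** By induction on the flag, each factor splits as [ev T] plus [strip p T]. The two prefixing terms
    of the shuffle give the mixed products, and the diamond gives the product of the two strips
    through [psum_mul]. *)
Lemma ev_prodf T k a b : good T -> posw a -> posw b ->
  (2 * (size a + size b) < k)%N ->
  lin (ev T) (prodf k true a b) = ev T a * ev T b.
Proof.
elim: T k a b => [|p T IH] k a b.
  case: a b => [|[n al] a] [|l' b] _ _ _; case: k => // k _.
  - by rewrite [prodf _ _ _ _]/= lin1 mul1r.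
  - by rewrite [prodf _ _ _ _]/= lin1 mul1r.
  - by rewrite [prodf _ _ _ _]/= lin1 mulr1.
  - by rewrite lin_ev0_prodf mul0r.
move=> gT; have /andP[z0 gT'] := gT.
case: a b => [|[[|na] al] a] [|[[|nb] be] b] // pa pb; case: k => // k sk.
- by rewrite [prodf _ _ _ _]/= lin1 ev_nil mul1r.
- by rewrite [prodf _ _ _ _]/= lin1 ev_nil mul1r.
- by rewrite [prodf _ _ _ _]/= lin1 ev_nil mulr1.
rewrite lin_ev_cons IH //.
case: k sk => // k sk.
set la := (na.+1, al); set lb := (nb.+1, be).
rewrite prodf_shuffleS prodf_diamondS !lin_cat !lin_strip_pre.
have sab : (2 * (size a + size b) < k)%N by move: sk => /=; lia.
have [pa' pb'] : posw a /\ posw b by [].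
rewrite !(IH k.+1) //; try by move: sk => /=; lia.
rewrite IH // lin_flatten.
have -> : \sum_(j <- iota 1 (na.+1 + nb.+1).-1)
   lin (strip p T) (scale_lc (DeltaC F na.+1 nb.+1 j)
     (pre ((na.+1 + nb.+1 - j)%N, al * be)
       (ext (prodf k true [:: xn F j]) (prodf k true a b)))) =
   inc (al * be) ^+ p.2 * (\sum_(j < (na + nb).+1)
      inc (DeltaC F na.+1 nb.+1 j.+1) * psum T p.1 (na + nb - j).+1 *
      \sum_(m <- monics T) m ^- j.+1) * (ev T a * ev T b).
  rewrite addnS big_iota1 addSn /= mulr_sumr mulr_suml.
  apply: eq_bigr => j _; rewrite lin_scale lin_strip_pre lin_ext.
  (* Words of the inner product have length at most [size a + size b], so the remaining fuel still
     suffices with x_j added. *)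
  rewrite (@eq_lin (posn (size a + size b)) _
     (fun w => ev T [:: xn F j.+1] * ev T w)); first last.
  - move=> w /andP[pw sw]; apply: IH => //.
    by move: sk sw => /=; lia.
  - exact: prodf_posn.
  rewrite linZ IH // ev_letter1 /= subSS subSn ?leq_ord //.
  by ring.
have := psum_mul na nb gT' z0; rewrite addSn addnS /= => E.
rewrite rmorphM exprMn.
set SA := psum T p.1 na.+1 in E *; set SB := psum T p.1 nb.+1 in E *.
set S2 := psum T p.1 _ in E *; set R := \sum_(j < _) _ in E *.
have -> : S2 = SA * SB - R by rewrite E addrK.
by ring.
Qed.

Lemma ev_shuffle T a b : good T -> posw a -> posw b ->
  lin (ev T) (shuffle a b) = ev T a * ev T b.
Proof. by move=> *; apply: ev_prodf => //; rewrite /fuel ltnW. Qed.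

Lemma shuffle_pos a b : posw a -> posw b ->
  all (fun p => posw p.2) (shuffle a b).
Proof.
by move=> pa pb; apply: sub_all (prodf_posn _ true pa pb) => p /andP[].
Qed.

(** * Evaluation of brackets *)

Definition shuffles (a : word F) : lc F :=
  foldr (fun l acc => shuffle_lc [:: (1, [:: l])] acc) [:: (1, [::])] a.

Lemma shuffles_cons l w :
  shuffles (l :: w) = scale_lc 1 (ext (shuffle [:: l]) (shuffles w)).
Proof. by rewrite /shuffles /= /shuffle_lc /= cats0. Qed.

Lemma shuffles_pos w : posw w -> all (fun p => posw p.2) (shuffles w).
Proof.
elim: w => [|l w IH] // /andP[l0 pw]; rewrite shuffles_cons all_scale.
apply: (all_ext (IH pw)) => v pv; apply: shuffle_pos => //.
by rewrite /= l0.
Qed.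

Lemma ev_shuffles T w : good T -> posw w ->
  lin (ev T) (shuffles w) = \prod_(l <- w) ev T [:: l].
Proof.
move=> gT; elim: w => [|l w IH]; first by rewrite lin1 ev_nil big_nil.
move=> /andP[l0 pw]; rewrite shuffles_cons lin_scale rmorph1 mul1r lin_ext.
rewrite (@eq_lin posw _ (fun u => ev T [:: l] * ev T u)); first last.
- by move=> v pv; rewrite ev_shuffle //= l0.
- exact: shuffles_pos.
by rewrite linZ IH // big_cons.
Qed.

Lemma bracket_pos w : posw w -> all (fun p => posw p.2) (bracket w).
Proof. by move=> pw; rewrite /bracket all_scale shuffles_pos. Qed.

(** The second binomial of [DeltaC] vanishes for i <= n; with n the weight of a word, the
    coefficients in [bracket] are mere divisibility indicators. *)
Lemma DeltaC1 n i : (0 < i <= n)%N ->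
  DeltaC F 1 n.+1 i = ((q.-1 %| i)%N)%:R.
Proof.
case: i => // i /andP[_ ni]; rewrite /DeltaC; case: ifP => // _.
by rewrite /= bin0 bin_small // expr0 mulr0n addr0.
Qed.

(** The sign and the indicator attached to each letter of the bracket are exactly the factor in
    [psum0]. *)
Lemma ev_bracket T s : good T -> all (fun i => 0 < i)%N s ->
  lin (ev T) (bracket (map (xn F) s)) = \prod_(i <- s) psum T 0 i.
Proof.
move=> gT s0; rewrite /bracket lin_scale -/(shuffles _) ev_shuffles //; last first.
  by rewrite /posw all_map.
rewrite !big_map size_map.
have -> : wt (map (xn F) s) = sumn s by rewrite /wt -map_comp map_id.
have : all (fun i => 0 < i <= sumn s)%N s.
  apply/allP => i si; rewrite (allP s0) //=.
  by elim: (s) si => //= j s' IH; rewrite inE => /predU1P[->|/IH]; lia.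
(* The weight in [DeltaC] must stay fixed while [s] shrinks, so it is generalized first. *)
move: (sumn s) => n; elim: s {s0} => [|i s IH] /=.
  by rewrite !(big_nil, expr0, mulr1, rmorph1).
case/andP=> hi hs; have /andP[i0 _] := hi.
rewrite !big_cons -(IH hs) DeltaC1 // psum0 //.
rewrite ev_letter1 exprS !rmorphM rmorphN1 rmorph_nat; ring.
Qed.

(** * Sums over compositions *)

Lemma comps_auxS k m : comps_aux k.+1 m.+1 =
  flatten [seq [seq i :: s | s <- comps_aux k (m.+1 - i)] | i <- iota 1 m.+1].
Proof. by []. Qed.

Lemma comps_aux_fuel k m : (m <= k)%N -> comps_aux k m = comps m.
Proof.
have H n : forall k k', (n <= k)%N -> (n <= k')%N -> comps_aux k n = comps_aux k' n.
  have [N] := ubnP n; elim: N n => // N IH [|n] nN [|k1] [|k2] // h1 h2.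
  rewrite !comps_auxS; congr (flatten _); apply/eq_in_map => i; rewrite mem_iota => hi.
  by rewrite (IH (n.+1 - i)%N _ k1 k2) //; lia.
by move=> mk; apply: H.
Qed.

Lemma compsS m : comps m.+1 =
  flatten [seq [seq i :: s | s <- comps (m.+1 - i)] | i <- iota 1 m.+1].
Proof.
rewrite {1}/comps comps_auxS; congr (flatten _); apply/eq_in_map => i.
by rewrite mem_iota => hi; rewrite comps_aux_fuel //; lia.
Qed.

Lemma comps_pos m : all (all (fun i => 0 < i)%N) (comps m).
Proof.
have [N] := ubnP m; elim: N m => // N IH [|m] mN //.
rewrite compsS all_flatten all_map; apply/allP => i; rewrite mem_iota => hi.
rewrite /= all_map; apply: sub_all (IH (m.+1 - i)%N _); last by lia.
by move=> s /= ->; rewrite andbT; case/andP: hi.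
Qed.

(** The coefficient of X^m in the inverse k-th power of 1 - sum_(i >= 1) S_i X^i, with S_i the power
    sum [psum T 0 i]. *)
Definition compsum T k m : K :=
  \sum_(s <- comps m) 'C((k + size s).-1, size s)%:R * \prod_(i <- s) psum T 0 i.

Lemma compsum0 T k : compsum T k 0 = 1.
Proof. by rewrite /compsum big_seq1 /= bin0 big_nil mulr1. Qed.

Lemma big_compsS m (f : seq nat -> K) : \sum_(s <- comps m.+1) f s =
  \sum_(i <- iota 1 m.+1) \sum_(s <- comps (m.+1 - i)) f (i :: s).
Proof.
by rewrite compsS big_flatten big_map; apply: eq_bigr => i _; rewrite big_map.
Qed.

Lemma compsum0S T m : compsum T 0 m.+1 = 0.
Proof.
rewrite /compsum big_compsS big1 // => i _; rewrite big1 // => s _.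
by rewrite bin_small ?mul0r.
Qed.

(** Pascal's rule after splitting off the first part; the recursion is that of [gquot_exp_rec]. *)
Lemma compsum_rec T k m : compsum T k.+1 m.+1 = compsum T k m.+1 +
  \sum_(i <- iota 1 m.+1) psum T 0 i * compsum T k.+1 (m.+1 - i).
Proof.
rewrite /compsum !big_compsS -big_split; apply: eq_bigr => i _ /=.
rewrite mulr_sumr -big_split; apply: eq_bigr => s _ /=.
by rewrite big_cons ?addSn !addnS /= binS natrD; ring.
Qed.

Lemma gquot_exp T k m : good T -> (gquot T ^+ k)`_m = compsum T k m.
Proof.
move=> gT; elim: k m => [|k IHk] m.
  rewrite expr0 coef1; case: m => [|m]; first by rewrite compsum0.
  by rewrite compsum0S.
have [N] := ubnP m; elim: N m => // N IHm [|m] mN.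
  by rewrite gquot_exp_rec // big_nil addr0 IHk !compsum0.
rewrite gquot_exp_rec // compsum_rec IHk; congr (_ + _).
apply: eq_big_seq => i; rewrite mem_iota => hi.
by rewrite IHm //; lia.
Qed.

(* The evaluation of the right factor of x_r in the reduced coproduct of x_n. *)
Definition branch T r n : K :=
  \sum_(w <- words1 F (n - r)) 'C((r + size w).-2, size w)%:R *
     lin (ev T) (bracket w).

(** Factoring X^r out of the r-th power of [gpol T] leaves a coefficient of degree n - r, which
    [gquot_exp] writes with the binomials and brackets of the coproduct. *)
Lemma branchE T n (r : 'I_n.+1) : good T ->
  branch T r.+1 n.+1 = (gpol T ^+ r)`_n.
Proof.
move=> gT; rewrite gpolE exprMn coefXnM ltnNge -ltnS ltn_ord /=.
rewrite gquot_exp // /branch /words1 subSS big_map /compsum.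
apply: eq_big_seq => s sm; rewrite size_map ev_bracket //.
exact: (allP (comps_pos _) _ sm).
Qed.

(** * Functionals on the coproduct *)

Definition lin2 (E1 E2 : word F -> K) (X : lc2 F) : K :=
  \sum_(p <- X) inc p.1 * E1 p.2.1 * E2 p.2.2.

Definition pos2 (p : F * (word F * word F)) := posw p.2.1 && posw p.2.2.

Lemma cop_letter_red_pos l : all pos2 (cop_letter_red l).
Proof.
rewrite /cop_letter_red all_flatten all_map; apply/allP => r; rewrite mem_iota.
case/andP=> r0 _; rewrite /= all_flatten all_map; apply/allP => w.
case/mapP=> s sm ->; rewrite /= all_map; apply: sub_all (bracket_pos _).
  by move=> p pp; rewrite /= /pos2 /= r0.
by rewrite /posw all_map; exact: (allP (comps_pos _) _ sm).
Qed.

Lemma coprod_cons l l' (v : word F) : coprod (l :: l' :: v) =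
  (1, ([::], l :: l' :: v)) ::
  flatten [seq flatten [seq [seq (p.1 * q.1 * s.1, (p.2.1 ++ q.2.1, s.2))
                            | s <- shuffle p.2.2 q.2.2]
                       | q <- coprod (l' :: v)]
          | p <- cop_letter_red l].
Proof. by []. Qed.

Lemma coprod_pos (u : word F) : posw u -> all pos2 (coprod u).
Proof.
elim: u => [|l [|l' v] IH] // pu.
  by move: pu; rewrite /= cop_letter_red_pos /pos2 /= => ->.
have /IH/allP pv : posw (l' :: v) by case/andP: pu.
rewrite coprod_cons -cat1s all_cat all_seq1 {1}/pos2 pu /=.
rewrite all_flatten all_map; apply/allP => p.
move=> /(allP (cop_letter_red_pos l))/andP[p1 p2].
rewrite /= all_flatten all_map; apply/allP => x /pv/andP[x1 x2].
rewrite /= all_map; apply: sub_all (shuffle_pos p2 x2) => s ps.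
by rewrite /= /pos2 /= /posw all_cat -!/(posw _) p1 x1.
Qed.

Lemma lin2_cop_letter_red E T l :
  lin2 E (ev T) (cop_letter_red l) =
  \sum_(r <- iota 1 l.1) branch T r l.1 * E [:: (r, l.2)].
Proof.
rewrite /lin2 /cop_letter_red big_flatten big_map; apply: eq_bigr => r _.
rewrite big_flatten big_map /branch mulr_suml; apply: eq_bigr => w _.
rewrite big_map /lin mulr_sumr mulr_suml; apply: eq_bigr => p _ /=.
by rewrite rmorphM rmorph_nat; ring.
Qed.

(** Right factors are shuffled, so [ev T] splits them into products. Left factors are concatenated,
    so [E] may be arbitrary and is merely precomposed with a prefix. *)
Lemma lin2_coprod_cons E T l (v : word F) : good T -> posw (l :: v) ->
  lin2 E (ev T) (coprod (l :: v)) = E [::] * ev T (l :: v) +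
  \sum_(r <- iota 1 l.1) branch T r l.1 *
     lin2 (fun w => E ((r, l.2) :: w)) (ev T) (coprod v).
Proof.
move=> gT pu; case: v pu => [|l' v] pu.
  rewrite /lin2 /= big_cons rmorph1 mul1r; congr (_ + _).
  rewrite -/(lin2 E (ev T) _) lin2_cop_letter_red; apply: eq_bigr => r _.
  by rewrite big_seq1 rmorph1 mul1r ev_nil mulr1.
rewrite coprod_cons {1}/lin2 big_cons rmorph1 mul1r; congr (_ + _).
have pv : posw (l' :: v) by case/andP: pu.
transitivity (\sum_(p <- cop_letter_red l) \sum_(x <- coprod (l' :: v))
   inc p.1 * inc x.1 * E (p.2.1 ++ x.2.1) * (ev T p.2.2 * ev T x.2.2)).
  rewrite big_flatten big_map; apply: eq_big_seq => p.
  move=> /(allP (cop_letter_red_pos l))/andP[p1 p2].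
  rewrite big_flatten big_map; apply: eq_big_seq => x.
  move=> /(allP (coprod_pos pv))/andP[x1 x2].
  rewrite big_map -ev_shuffle // /lin mulr_sumr; apply: eq_bigr => s _ /=.
  by rewrite !rmorphM; ring.
rewrite exchange_big /=.
transitivity (\sum_(x <- coprod (l' :: v)) inc x.1 * ev T x.2.2 *
  lin2 (fun w => E (w ++ x.2.1)) (ev T) (cop_letter_red l)).
  apply: eq_bigr => x _; rewrite /lin2 mulr_sumr; apply: eq_bigr => p _.
  by ring.
rewrite (eq_bigr (fun x => \sum_(r <- iota 1 l.1) inc x.1 * ev T x.2.2 *
  (branch T r l.1 * E ((r, l.2) :: x.2.1)))); last first.
  by move=> x _; rewrite lin2_cop_letter_red mulr_sumr.
rewrite exchange_big; apply: eq_bigr => r _.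
rewrite /lin2 mulr_sumr; apply: eq_bigr => x _ /=.
by ring.
Qed.

(** * Concatenated flags, and images of flags modulo a span *)

Definition gmap T (T' : flag) : flag := [seq ((gpol T).[p.1], p.2) | p <- T'].

(** Each new step of [T'] modifies both sides by the same recursion. Coassociativity rests on this
    composition law. *)
Lemma gpol_cat T' T x :
  (gpol (T' ++ T)).[x] = (gpol (gmap T T')).[(gpol T).[x]].
Proof.
elim: T' x => [|p T' IH] x; first by rewrite hornerX.
by rewrite cat_cons /gmap map_cons -/(gmap T T') !gpol_cons !IH.
Qed.

Lemma good_cons p T : good (p :: T) = ((gpol T).[p.1] != 0) && good T.
Proof. by []. Qed.

Lemma good_cat T' T : good (T' ++ T) = good T && good (gmap T T').
Proof.
elim: T' => [|p T' IH]; first by rewrite andbT.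
rewrite cat_cons /gmap map_cons -/(gmap T T').
by rewrite !good_cons gpol_cat IH andbCA.
Qed.

Lemma gmap_cat T T1 T2 : gmap T (T1 ++ T2) = gmap T T1 ++ gmap T T2.
Proof. exact: map_cat. Qed.

Lemma gmap_comp T2 T1 T3 : gmap (T2 ++ T1) T3 = gmap (gmap T1 T2) (gmap T1 T3).
Proof. by rewrite /gmap -map_comp; apply: eq_map => p /=; rewrite gpol_cat. Qed.

Lemma big_span_cat T' T (f : K -> K) : \sum_(v <- span (T' ++ T)) f v =
  \sum_(x <- span T') \sum_(v <- span T) f (x + v).
Proof.
elim: T' f => [|p T' IH] f.
  by rewrite /= big_seq1; apply: eq_bigr => v _; rewrite add0r.
rewrite cat_cons !big_span_cons; apply: eq_bigr => c _; rewrite IH.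
by apply: eq_bigr => x _; apply: eq_bigr => v _; rewrite addrA.
Qed.

Lemma big_span_gmap T T' (f : K -> K) :
  \sum_(v <- span (gmap T T')) f v = \sum_(v <- span T') f (gpol T).[v].
Proof.
elim: T' f => [|p T' IH] f; first by rewrite /= !big_seq1 gpol0.
rewrite /gmap map_cons -/(gmap T T') !big_span_cons; apply: eq_bigr => c _.
by rewrite IH; apply: eq_bigr => v _; rewrite gpolD gpolZ.
Qed.

Lemma gpol_span_cat T' T v : v \in span T' -> (gpol (T' ++ T)).[v] = 0.
Proof.
move=> vT; apply: gpol_span.
elim: T' v vT => [|p T' IH] v.
  by rewrite inE => /eqP->; exact: mem0_span.
move=> /allpairsP[[c w] /= [cF wT ->]]; apply/allpairsP; exists (c, w).
by split => //=; exact: IH.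
Qed.

(** The sum over the span of T is expanded in inverse powers of g(t + x) = g(t) + g(x) by
    [psum_expand]; summing over x then gives power sums of the image flag. *)
Lemma psum_cat T' T t n : good T -> (gpol (T' ++ T)).[t] != 0 ->
  psum (T' ++ T) t n.+1 = \sum_(r <- iota 1 n.+1)
    branch T r n.+1 * psum (gmap T T') (gpol T).[t] r.
Proof.
move=> gT t0; rewrite {1}/psum big_span_cat big_iota1.
transitivity (\sum_(x <- span T') \sum_(r < n.+1)
    branch T r.+1 n.+1 * (gpol T).[t + x] ^- r.+1).
  apply: eq_big_seq => x xT.
  transitivity (psum T (t + x) n.+1).
    by apply: eq_bigr => v _; rewrite addrA.
  rewrite psum_expand //.
    by apply: eq_bigr => r _; rewrite branchE.
  apply: contra_neq t0 => tx0.
  have := gpol_cat T' T (t + x); rewrite tx0 gpol0 gpolD.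
  by rewrite (gpol_span_cat _ xT) addr0.
rewrite exchange_big; apply: eq_bigr => r _ /=.
rewrite -mulr_sumr /psum big_span_gmap; congr (_ * _).
by apply: eq_bigr => v _; rewrite gpolD.
Qed.

(** Induction on the upper flag. With no upper step, only the left factor 1 survives; a new top step
    either reads no letter or reads the first one, where [psum_cat] applies. *)
Lemma ev_coprod T' T w : good (T' ++ T) -> posw w ->
  lin2 (ev (gmap T T')) (ev T) (coprod w) = ev (T' ++ T) w.
Proof.
elim: T' w => [|p T' IH] [|l v].
- by move=> _ _; rewrite /lin2 big_seq1 rmorph1 !ev_nil !mulr1.
- move=> gT pw; rewrite lin2_coprod_cons // ev_nil mul1r big1 ?addr0 // => r _.
  by rewrite /lin2 big1 ?mulr0 // => x _; rewrite mulr0 mul0r.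
- by move=> _ _; rewrite /lin2 big_seq1 rmorph1 !ev_nil !mulr1.
rewrite cat_cons good_cons => /andP[p0 gTT] pw.
have gT : good T by move: gTT; rewrite good_cat => /andP[].
have pv : posw v by case/andP: pw.
rewrite lin2_coprod_cons // ev_nil mul1r.
rewrite /gmap map_cons -/(gmap T T').
set p' := ((gpol T).[p.1], p.2).
transitivity (lin2 (ev (gmap T T')) (ev T) (coprod (l :: v)) +
   inc l.2 ^+ p.2 * (\sum_(r <- iota 1 l.1) branch T r l.1 *
     psum (gmap T T') (gpol T).[p.1] r) *
   lin2 (ev (gmap T T')) (ev T) (coprod v)).
  rewrite lin2_coprod_cons // ev_nil mul1r -addrA; congr (_ + _).
  rewrite mulr_sumr mulr_suml -big_split; apply: eq_bigr => r _ /=.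
  have -> : lin2 (ev (p' :: gmap T T') \o cons (r, l.2)) (ev T) (coprod v) =
     lin2 (fun w => ev (gmap T T') ((r, l.2) :: w)) (ev T) (coprod v) +
     inc l.2 ^+ p.2 * psum (gmap T T') (gpol T).[p.1] r *
     lin2 (ev (gmap T T')) (ev T) (coprod v).
    rewrite /lin2 mulr_sumr -big_split; apply: eq_bigr => x _ /=.
    by ring.
  by ring.
rewrite !IH //; case: l pw => [[|n] e] pw //.
by rewrite -psum_cat.
Qed.

End Flags.

(** * Separation by evaluations *)

Section Independence.
Variables (F : finFieldType) (K : closedFieldType) (inc : {rmorphism F -> K}).
Implicit Types (T : flag K) (t : K).

(** If P is nonzero, P X + 1 is not constant, and a root of it is a nonzero point where P does not
    vanish. *)
Lemma poly_zero_everywhere (P : {poly K}) :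
  (forall z, z != 0 -> P.[z] = 0) -> P = 0.
Proof.
move=> P0; apply/eqP/negPn/negP => Pn0.
have /closed_rootP[z] : size (P * 'X + 1) != 1%N.
  rewrite size_polyDl ?size_mulX ?size_poly1 ?eqSS ?size_poly_eq0 //.
  by rewrite ltnS lt0n size_poly_eq0.
rewrite rootE !hornerE; have [->|/P0->] := eqVneq z 0.
  by rewrite mulr0 add0r oner_eq0.
by rewrite mul0r add0r oner_eq0.
Qed.

(** The linear coefficient of [gpol F T] is 1, so subtracting a constant leaves a nonconstant
    polynomial, which has a root. *)
Lemma gpol_surj T y : exists t, (gpol F T).[t] = y.
Proof.
have /closed_rootP[t] : size (gpol F T - y%:P) != 1%N.
  apply: contraTneq (oner_neq0 K) => s1; rewrite negbK.
  have := nth_default 0 (eq_leq s1).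
  by rewrite coefB coefC gpolE coefXM /= (gquot0 inc) subr0 => ->.
by rewrite rootE !hornerE subr_eq0 => /eqP <-; exists t.
Qed.

(** With z = 1 / g(t), the n-th power sum is z Q_n(z) with Q_n monic of degree n - 1, and every
    nonzero z occurs. Distinct degrees give independence. *)
Lemma psum_indep (I : eqType) (r : seq I) (h : I -> K) (n : I -> nat) T :
  good F T -> all (fun i => 0 < n i)%N r ->
  (forall t, (gpol F T).[t] != 0 -> \sum_(i <- r) h i * psum inc T t (n i) = 0) ->
  forall m, \sum_(i <- r | n i == m) h i = 0.
Proof.
move=> gT n0 H.
pose Q m := \poly_(s < m) (gpol F T ^+ s)`_m.-1.
have R0 : \sum_(i <- r) h i *: Q (n i) = 0.
  apply: poly_zero_everywhere => z z0; have [t tz] := gpol_surj T z^-1.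
  have t0 : (gpol F T).[t] != 0 by rewrite tz invr_eq0.
  apply: (mulfI z0); rewrite mulr0 -(H t t0) horner_sum mulr_sumr.
  apply: eq_big_seq => i /(allP n0); case: (n i) => // k _.
  rewrite hornerZ psum_expand // horner_poly mulrCA mulr_sumr; congr (_ * _).
  by apply: eq_bigr => s _; rewrite tz exprVn invrK exprS mulrCA.
pose N := \max_(i <- r) n i.
have nN i : i \in r -> (n i <= N)%N.
  by move=> ir; rewrite /N; apply: (@leq_bigmax_seq _ r xpredT n).
pose S m := \sum_(i <- r | n i == m) h i.
have S0 m : (N < m)%N -> S m = 0.
  move=> Nm; rewrite /S big_seq_cond big1 // => i /andP[/nN ni /eqP nm].
  by rewrite -nm ltnNge ni in Nm.
have S00 : S 0%N = 0.
  rewrite /S big_seq_cond big1 // => i /andP[/(allP n0)].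
  by case: (n i).
have RE : \sum_(m < N.+1) S m *: Q m = 0.
  rewrite -[RHS]R0 /S; under eq_bigr do rewrite scaler_suml big_mkcond.
  rewrite exchange_big; apply: eq_big_seq => i /nN ni /=.
  rewrite (bigD1 (Ordinal (ni : n i < N.+1)%N)) //= eqxx big1 ?addr0 // => m.
  by rewrite -val_eqE /= eq_sym => /negbTE->.
(* Descending induction on m: in degree m - 1 only the [Q k] with k >= m appear, those with k > m
   have [S k = 0], and [Q m] has coefficient 1. *)
move=> m; have [d] := ubnP (N.+1 - m)%N; elim: d m => // d IH m md.
rewrite -/(S m); case: m md => [//|m] md.
have [mN|/S0//] := leqP m.+1 N.
have := congr1 (fun P : {poly K} => P`_m) RE; rewrite coef0 coef_sum.
rewrite (bigD1 (Ordinal (mN : m.+1 < N.+1)%N)) //= coefZ coef_poly ltnSn /=.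
rewrite gpolE exprMn coefXnM ltnn subnn -horner_coef0 horner_exp horner_coef0.
rewrite (gquot0 inc) expr1n mulr1 big1 ?addr0 // => k; rewrite -val_eqE /= coefZ => km.
rewrite coef_poly; case: ltnP => [mk|_]; last by rewrite mulr0.
rewrite [S k]IH ?mul0r //; have := ltn_ord k; lia.
Qed.

(** The free exponent k separates characters, since power functions span all functions on F;
    [psum_indep] then separates weights. *)
Lemma letter_indep (I : eqType) (r : seq I) (h : I -> K) (l : I -> letter F) T :
  good F T -> all (fun i => 0 < (l i).1)%N r ->
  (forall t k, (gpol F T).[t] != 0 ->
     \sum_(i <- r) h i * (inc (l i).2 ^+ k * psum inc T t (l i).1) = 0) ->
  forall x, \sum_(i <- r | l i == x) h i = 0.
Proof.
move=> gT l0 H [m e].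
(* [P] interpolates the indicator function of [e] on F. *)
pose P : {poly F} := 1 - ('X - e%:P) ^+ (qF F).-1.
have PE c : P.[c] = (c == e)%:R.
  rewrite !hornerE; have [->|ce] := eqVneq c e.
    rewrite subrr expr0n; have := predq_gt0 F.
    by case: (qF F).-1 => // *; rewrite subr0.
  by rewrite expf_predq ?subr_eq0 // subrr.
pose h' i := h i * inc ((l i).2 == e)%:R.
rewrite -[RHS](@psum_indep _ r h' (fun i => (l i).1) T gT l0 _ m); last first.
  move=> t t0; transitivity (\sum_(k < size P) inc P`_k *
      \sum_(i <- r) h i * (inc (l i).2 ^+ k * psum inc T t (l i).1)).
    under [RHS]eq_bigr do rewrite mulr_sumr.
    rewrite exchange_big; apply: eq_bigr => i _.
    rewrite /h' -PE horner_coef rmorph_sum.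
    rewrite [X in X * psum _ _ _ _]mulr_sumr mulr_suml.
    by apply: eq_bigr => k _; rewrite rmorphM rmorphXn; ring.
  by rewrite big1 // => k _; rewrite H // mulr0.
rewrite [LHS]big_mkcond [RHS]big_mkcond; apply: eq_bigr => i _.
rewrite /h'; case: (l i) => a b /=; rewrite xpair_eqE.
by case: eqP => _ //=; case: eqP => _; rewrite ?rmorph1 ?rmorph0 ?mulr1 ?mulr0.
Qed.

(** Adding a top step to T and subtracting the relation at T isolates the first letters;
    [letter_indep] selects one of them, and the tails satisfy the same relation for every T. The
    empty flag detects the empty word. *)
Lemma ev_indep (I : eqType) (r : seq I) (f : I -> K) (w : I -> word F) :
  all (fun i => posw (w i)) r ->
  (forall T, good F T -> \sum_(i <- r) f i * ev inc T (w i) = 0) ->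
  forall u, \sum_(i <- r | w i == u) f i = 0.
Proof.
move=> wr H u; elim: u r f w wr H => [|l u IH] r f w wr H.
  rewrite -[RHS](H [::]) // big_mkcond; apply: eq_bigr => i _.
  by case: (w i) => [|? ?] /=; rewrite ?mulr1 ?mulr0.
have wE i : (w i == l :: u) =
    (ohead (w i) == Some l) && (behead (w i) == u).
  by case: (w i).
rewrite (eq_bigl _ _ wE) -big_filter_cond.
apply: IH => [|T gT].
  rewrite all_filter; apply/allP => i /(allP wr) wi; apply/implyP => _.
  by move: wi; case: (w i) => // l' v /andP[].
rewrite big_filter.
(* Empty words are removed because the default letter has weight 0, while [letter_indep] asks for
   positive weights. *)
pose r1 := [seq i <- r | w i != [::]].
pose lt i := head (xn F 0) (w i).
transitivity (\sum_(i <- r1 | lt i == l) f i * ev inc T (behead (w i))).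
  rewrite big_filter_cond; apply: eq_bigl => i.
  by rewrite /lt; case: (w i).
apply: (@letter_indep _ r1 (fun i => f i * ev inc T (behead (w i))) lt T gT).
  rewrite all_filter; apply/allP => i /(allP wr) wi; apply/implyP.
  by move: wi; rewrite /lt; case: (w i) => // l' v /andP[].
move=> t k t0.
have gT' : good F ((t, k) :: T) by rewrite good_cons t0 gT.
have := H _ gT'; rewrite -[RHS](H T gT).
under eq_bigr do rewrite ev_cons mulrDr.
rewrite big_split /= => /(canRL (addKr _)); rewrite addNr => E.
rewrite -[RHS]E big_filter big_mkcond; apply: eq_bigr => i _.
by rewrite /lt; case: (w i) => [|l' v] /=; rewrite ?mulr0 //; ring.
Qed.

Lemma gmap_surj T T' : exists T2, gmap F T T2 = T'.
Proof.
elim: T' => [|[y k] T' [T2 E]]; first by exists [::].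
by have [t ty] := gpol_surj T y; exists ((t, k) :: T2); rewrite /= E ty.
Qed.

(** * Functionals on the triple tensor product *)

Definition lin3 (E1 E2 E3 : word F -> K) (X : lc3 F) : K :=
  \sum_(p <- X) inc p.1 * (E1 p.2.1.1 * E2 p.2.1.2 * E3 p.2.2).

Definition pos3 (p : F * (word F * word F * word F)) :=
  [&& posw p.2.1.1, posw p.2.1.2 & posw p.2.2].

Lemma lin3_id_tens_cop E1 E2 E3 (X : lc2 F) : lin3 E1 E2 E3 (id_tens_cop X) =
  \sum_(p <- X) inc p.1 * E1 p.2.1 * lin2 inc E2 E3 (coprod p.2.2).
Proof.
rewrite /lin3 big_flatten big_map; apply: eq_bigr => p _.
rewrite big_map mulr_sumr; apply: eq_bigr => x _ /=.
by rewrite rmorphM; ring.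
Qed.

Lemma lin3_cop_tens_id E1 E2 E3 (X : lc2 F) : lin3 E1 E2 E3 (cop_tens_id X) =
  \sum_(p <- X) inc p.1 * lin2 inc E1 E2 (coprod p.2.1) * E3 p.2.2.
Proof.
rewrite /lin3 big_flatten big_map; apply: eq_bigr => p _.
rewrite big_map /lin2 mulr_sumr mulr_suml; apply: eq_bigr => x _ /=.
by rewrite rmorphM; ring.
Qed.

Lemma id_tens_cop_pos (X : lc2 F) : all (@pos2 F) X -> all pos3 (id_tens_cop X).
Proof.
move=> /allP XP; rewrite all_flatten all_map; apply/allP => p /XP/andP[p1 p2].
rewrite /= all_map; apply: sub_all (coprod_pos p2) => x /andP[x1 x2].
by rewrite /pos3 /= p1 x1 x2.
Qed.

Lemma cop_tens_id_pos (X : lc2 F) : all (@pos2 F) X -> all pos3 (cop_tens_id X).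
Proof.
move=> /allP XP; rewrite all_flatten all_map; apply/allP => p /XP/andP[p1 p2].
rewrite /= all_map; apply: sub_all (coprod_pos p1) => x /andP[x1 x2].
by rewrite /pos3 /= p2 x1 x2.
Qed.

(* Both sides evaluate [u] at the concatenated flag T3 ++ T2 ++ T1, where T2 and
   T3 are lifts of the flags U2 and U3. *)
Lemma lin3_coassoc T1 U2 U3 u : good F T1 -> good F U2 -> good F U3 -> posw u ->
  lin3 (ev inc U3) (ev inc U2) (ev inc T1) (id_tens_cop (coprod u)) =
  lin3 (ev inc U3) (ev inc U2) (ev inc T1) (cop_tens_id (coprod u)).
Proof.
have [T2 <-] := gmap_surj T1 U2; have [T3 <-] := gmap_surj (T2 ++ T1) U3.
move=> g1 g2 g3 pu.
have g21 : good F (T2 ++ T1) by rewrite good_cat g1 g2.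
have g321 : good F (T3 ++ T2 ++ T1) by rewrite good_cat g21 g3.
transitivity (ev inc (T3 ++ T2 ++ T1) u).
  rewrite -ev_coprod // lin3_id_tens_cop; apply: eq_big_seq => p.
  by move=> /(allP (coprod_pos pu))/andP[p1 p2]; rewrite ev_coprod.
have g32 : good F (gmap F T1 (T3 ++ T2)).
  by move: g321; rewrite catA good_cat => /andP[].
(* Now T1 is split off first: left factors are evaluated at the image of [T3 ++ T2], and [gmap_comp]
   shows that its upper part is the image of T3 under [T2 ++ T1]. *)
rewrite catA -ev_coprod -?catA // lin3_cop_tens_id; apply: eq_big_seq => p.
move=> /(allP (coprod_pos pu))/andP[p1 p2].
rewrite gmap_comp ev_coprod //; last by rewrite -gmap_cat.
by rewrite -gmap_cat.
Qed.

(** One tensor factor is isolated at a time: varying T3 fixes the first word, then T2 the second,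
    then T1 the third. *)
Lemma lin3_indep (X : lc3 F) : all pos3 X ->
  (forall T1 T2 T3, good F T1 -> good F T2 -> good F T3 ->
     lin3 (ev inc T3) (ev inc T2) (ev inc T1) X = 0) ->
  forall s, coef3 X s = 0.
Proof.
move=> XP H [[a b] c]; apply: (fmorph_inj inc); rewrite rmorph0.
have /and3P[Xa Xb Xc] :
   [&& all (fun p : F * (word F * word F * word F) => posw p.2.1.1) X,
       all (fun p : F * (word F * word F * word F) => posw p.2.1.2) X &
       all (fun p : F * (word F * word F * word F) => posw p.2.2) X].
  by apply/and3P; split; apply: sub_all XP => p /and3P[].
have H1 T1 T2 : good F T1 -> good F T2 ->
    \sum_(p <- X | p.2.1.1 == a) inc p.1 * ev inc T2 p.2.1.2 * ev inc T1 p.2.2 = 0.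
  move=> g1 g2; apply: ev_indep => // T3 g3; rewrite -[RHS](H _ _ _ g1 g2 g3).
  by apply: eq_bigr => p _; ring.
have H2 T1 : good F T1 ->
    \sum_(p <- [seq p <- X | p.2.1.1 == a] | p.2.1.2 == b)
      inc p.1 * ev inc T1 p.2.2 = 0.
  move=> g1; apply: ev_indep => [|T2 g2].
    by rewrite all_filter; apply: sub_all Xb => p /= ->; rewrite implybT.
  by rewrite big_filter -[RHS](H1 _ _ g1 g2); apply: eq_bigr => p _; ring.
rewrite -[RHS](@ev_indep _ [seq p <- [seq p <- X | p.2.1.1 == a] | p.2.1.2 == b]
   (fun p => inc p.1) (fun p => p.2.2) _ _ c).
- rewrite /coef3 rmorph_sum -filter_predI big_filter_cond [RHS]big_mkcond.
  apply: eq_bigr => -[d [[a' b'] c']] _ /=; rewrite !xpair_eqE.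
  by rewrite (andbC (b' == b)); case: ifP => // _; rewrite rmorph0.
- by rewrite !all_filter; apply: sub_all Xc => p /= ->; rewrite !implybT.
- by move=> T1 g1; rewrite big_filter -[RHS](H2 _ g1).
Qed.

End Independence.

Theorem theorem6p8 (F : finFieldType) (u : word F) (hu : in_Gamma_word u) :
  coef3 (id_tens_cop (coprod u)) =1 coef3 (cop_tens_id (coprod u)).
Proof.
have [K [inc _]] := countable_algebraic_closure F.
have pu : posw u by apply: sub_all hu => l /andP[].
move=> t; apply/eqP; rewrite -subr_eq0; apply/eqP.
set X := id_tens_cop _; set Y := cop_tens_id _.
pose Y' : lc3 F := [seq (- p.1, p.2) | p <- Y].
have <- : coef3 (X ++ Y') t = coef3 X t - coef3 Y t.
  rewrite /coef3 big_cat big_map -sumrN; congr (_ + _); apply: eq_bigr => p _ /=.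
  by case: ifP; rewrite ?oppr0.
apply: (@lin3_indep F K inc).
  rewrite all_cat id_tens_cop_pos ?coprod_pos //= all_map.
  by have := cop_tens_id_pos (coprod_pos pu); apply: sub_all.
move=> T1 T2 T3 g1 g2 g3; rewrite /lin3 big_cat big_map /= -!/(lin3 _ _ _ _ _).
have := lin3_coassoc inc g1 g2 g3 pu; rewrite /lin3 -/X -/Y => ->.
by rewrite -big_split big1 // => p _; rewrite /= rmorphN mulNr subrr.
Qed.
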